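(* For $\alpha,\kappa\ge0$ consider the Riemann problem $(\mathrm{RP}_{\alpha,\kappa})$: $$h_t+\left(\alpha h^2b+\frac{\kappa h^3}{3}\right)_x=0,\qquad b_t+\left(\alpha hb^2+\frac{\kappa h^2b}{3}\right)_x=0,$$ $$(h,b)(x,0)=(h_-,b_-)\ \text{ if } x<0,\qquad (h,b)(x,0)=(h_+,b_+)\ \text{ if } x>0,$$ where $h_\pm,b_\pm\ge 0$ are fixed and at most one of $h_-,h_+,b_-,b_+$ is zero. Let $\mathbf{U}^{\alpha,\kappa}$ denote its solution. Then for every $T>0$ the following hold. 1. Let $\alpha=1/2$. When $\kappa\to0$, the solution $\mathbf{U}^{1/2,\kappa}(\cdot,t)$ converges, for $t\in[0,T]$, in the space of Radon measures $\mathcal{M}_{loc}(\mathbb{R};\mathbb{R}^2)$ to the solution $\mathbf{U}^{1/2,0}(\cdot,t)$ of the Riemann problem with the same data for the system $$h_t+(h^2b/2)_x=0,\qquad b_t+(hb^2/2)_x=0.$$ 2. Let $\kappa=1$. When $\alpha\to0$, the solution $\mathbf{U}^{\alpha,1}(\cdot,t)$ converges, for $t\in[0,T]$, in the space of Radon measures $\mathcal{M}_{loc}(\mathbb{R};\mathbb{R}^2)$ to the solution $\mathbf{U}^{0,1}(\cdot,t)$ of the Riemann problem with the same data for the system $$h_t+(hf(h))_x=0,\qquad b_t+(bf(h))_x=0,\qquad f(h)=\frac{h^2}{3}.$$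
   Context: The parameters tending to zero are positive. $\mathcal{M}_{loc}(\mathbb{R};\mathbb{R}^2)$ is the space of $\mathbb{R}^2$-valued (locally finite) Radon measures on $\mathbb{R}$, with convergence tested against compactly supported test functions; locally integrable functions are identified with the corresponding absolutely continuous measures. Notion of solution. The state space is $\mathcal{U}=\{(h,b)^\top: h,b\ge0\}$. Put $\lambda_1(h,b)=\alpha hb+\frac{\kappa h^2}{3}$ and $\lambda_2(h,b)=3\lambda_1(h,b)$, and let $[\![v]\!]=v_r-v_l$ denote the jump (right value minus left value). Solutions of the Riemann problem are self-similar and consist of finitely many constant states in $\mathcal{U}$ separated by waves of the following kinds, arranged from left to right in order of nondecreasing speed (adjacent waves may be attached to each other without a constant state of positive width in between, forming a composite wave): (i) contact discontinuity $J$ between $U_l$ and $U_r$, moving with speed $\lambda_1(U_l)=\lambda_1(U_r)$; (ii) shock wave $S$ between $U_l=(h_l,b_l)$ and $U_r=(h_r,b_r)$, moving with speed $\sigma$, satisfying the Rankine–Hugoniot conditions $\sigma[\![h]\!]=[\![h\lambda_1(h,b)]\!]$, $\sigma[\![b]\!]=[\![b\lambda_1(h,b)]\!]$ and the Lax entropy conditions $\lambda_2(U_r)<\sigma<\lambda_2(U_l)$, $\lambda_1(U_l)<\sigma$ (in the interior of $\mathcal{U}$ this means $b_r/h_r=b_l/h_l$, $h_r<h_l$, $b_r<b_l$); (iii) rarefaction wave $R$: a continuous fan in which $\lambda_2(h,b)=x/t$ and $(h,b)$ stays on a ray $b/h=\text{const}$, with $h$ and $b$ nondecreasing from left to right; (iv)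 delta shock $\delta S$ (occurring when $h_+=0$): $h$ is $h_-$ for $x<\sigma_\delta t$ and $0$ for $x>\sigma_\delta t$, while $b$ is, at each time $t$, the measure equal to $b_-$ for $x<\sigma_\delta t$, $b_+$ for $x>\sigma_\delta t$, plus the Dirac mass $\beta(t)\delta(x-\sigma_\delta t)$ with $\beta(0)=0$. It is required to satisfy $\sigma_\delta[\![h]\!]=[\![h\lambda_1(h,b)]\!]$, $\frac{d\beta}{dt}=\sigma_\delta[\![b]\!]-[\![b\lambda_1(h,b)]\!]$, and the overcompressibility condition $0=\lambda_1(h_+,b_+)<\sigma_\delta=\lambda_1(h_-,b_-)<\lambda_2(h_-,b_-)$. The two limit systems are the system $h_t+\left(\alpha h^2b+\frac{\kappa h^3}{3}\right)_x=0$, $b_t+\left(\alpha hb^2+\frac{\kappa h^2b}{3}\right)_x=0$ with $(\alpha,\kappa)=(1/2,0)$ and $(\alpha,\kappa)=(0,1)$ respectively, and their Riemann solutions are understood in the same sense. *)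

(* Defs.v *)
From HB Require Import structures.
From mathcomp Require Import all_boot all_order all_algebra.
From mathcomp Require Import all_classical all_reals all_analysis.

Set Implicit Arguments.
Unset Strict Implicit.
Unset Printing Implicit Defensive.

Import Order.TTheory GRing.Theory Num.Theory.
Import numFieldNormedType.Exports.

Local Open Scope classical_set_scope.
Local Open Scope ring_scope.

(* A state U = (h, b) is a pair: U.1 is h and U.2 is b. *)

Definition in_state_space (R : realType) (U : R * R) : Prop :=
  0 <= U.1 /\ 0 <= U.2.

Definition lambda1 (R : realType) (alpha kappa : R) (U : R * R) : R :=
  alpha * U.1 * U.2 + kappa * U.1 ^+ 2 / 3.

Definition lambda2 (R : realType) (alpha kappa : R) (U : R * R) : R :=
  3 * lambda1 alpha kappa U.

(* [Contact s] and [Shock s] travel with speed s; [Rarefaction s1 s2 W] is the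
   fan U(x, t) = W (x / t) for s1 <= x / t <= s2; [DeltaShockB s beta] (resp.
   [DeltaShockH s beta]) carries at time t the mass beta t in the component b
   (resp. h) at the point s * t. *)
Inductive wave (R : realType) : Type :=
| Contact of R
| Shock of R
| Rarefaction of R & R & (R -> R * R)
| DeltaShockB of R & (R -> R)
| DeltaShockH of R & (R -> R).

Definition first_speed (R : realType) (w : wave R) : R :=
  match w with
  | Contact s | Shock s | DeltaShockB s _ | DeltaShockH s _ => s
  | Rarefaction s1 _ _ => s1
  end.

Definition last_speed (R : realType) (w : wave R) : R :=
  match w with
  | Contact s | Shock s | DeltaShockB s _ | DeltaShockH s _ => s
  | Rarefaction _ s2 _ => s2
  end.

Definition is_contact (R : realType) (alpha kappa : R) (Ul Ur : R * R) (s : R)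
    : Prop :=
  s = lambda1 alpha kappa Ul /\ s = lambda1 alpha kappa Ur.

Definition is_shock (R : realType) (alpha kappa : R) (Ul Ur : R * R) (s : R)
    : Prop :=
  let l1 := lambda1 alpha kappa in
  let l2 := lambda2 alpha kappa in
  [/\ s * (Ur.1 - Ul.1) = Ur.1 * l1 Ur - Ul.1 * l1 Ul,
      s * (Ur.2 - Ul.2) = Ur.2 * l1 Ur - Ul.2 * l1 Ul,
      l2 Ur < s < l2 Ul
    & l1 Ul < s].

Definition is_rarefaction (R : realType) (alpha kappa : R) (Ul Ur : R * R)
    (s1 s2 : R) (W : R -> R * R) : Prop :=
  let l2 := lambda2 alpha kappa in
  [/\ [/\ s1 = l2 Ul, s2 = l2 Ur & s1 < s2],
      W s1 = Ul /\ W s2 = Ur,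
      {within `[s1, s2], continuous W},
      (exists2 c : R, 0 <= c &
         forall xi, s1 <= xi <= s2 -> (W xi).2 = c * (W xi).1 /\ l2 (W xi) = xi)
    & (forall xi eta, s1 <= xi -> xi <= eta -> eta <= s2 ->
         (W xi).1 <= (W eta).1 /\ (W xi).2 <= (W eta).2)].

(* The mass of a delta shock: beta 0 = 0 and dbeta/dt = c for all t > 0. *)
Definition delta_mass (R : realType) (beta : R -> R) (c : R) : Prop :=
  [/\ beta 0 = 0,
      {within `[0, +oo[, continuous beta}
    & forall t : R, 0 < t -> is_derive t (1 : R) beta c].

Definition overcompressive (R : realType) (alpha kappa : R) (Ul Ur : R * R)
    (s : R) : Prop :=
  [/\ 0 = lambda1 alpha kappa Ur,
      lambda1 alpha kappa Ur < s,
      s = lambda1 alpha kappa Ul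
    & lambda1 alpha kappa Ul < lambda2 alpha kappa Ul].

Definition is_delta_shockB (R : realType) (alpha kappa : R) (Ul Ur : R * R)
    (s : R) (beta : R -> R) : Prop :=
  let l1 := lambda1 alpha kappa in
  [/\ Ur.1 = 0,
      s * (Ur.1 - Ul.1) = Ur.1 * l1 Ur - Ul.1 * l1 Ul,
      delta_mass beta (s * (Ur.2 - Ul.2) - (Ur.2 * l1 Ur - Ul.2 * l1 Ul))
    & overcompressive alpha kappa Ul Ur s].

(* Mirror image of [is_delta_shockB]: the roles of h and b are exchanged.
   If alpha > 0 and kappa = 0 the system is invariant under this exchange, and a
   right state with b = 0 cannot be reached by any of the other waves from a
   left state with h, b > 0.  If kappa > 0 the condition
   lambda1 (h_r, 0) = 0 forces h_r = 0, so that the case of a right state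
   (h_r, 0) with h_r > 0 does not occur. *)
Definition is_delta_shockH (R : realType) (alpha kappa : R) (Ul Ur : R * R)
    (s : R) (beta : R -> R) : Prop :=
  let l1 := lambda1 alpha kappa in
  [/\ Ur.2 = 0,
      s * (Ur.2 - Ul.2) = Ur.2 * l1 Ur - Ul.2 * l1 Ul,
      delta_mass beta (s * (Ur.1 - Ul.1) - (Ur.1 * l1 Ur - Ul.1 * l1 Ul))
    & overcompressive alpha kappa Ul Ur s].

Definition is_wave (R : realType) (alpha kappa : R) (Ul : R * R) (w : wave R)
    (Ur : R * R) : Prop :=
  match w with
  | Contact s => is_contact alpha kappa Ul Ur s
  | Shock s => is_shock alpha kappa Ul Ur s
  | Rarefaction s1 s2 W => is_rarefaction alpha kappa Ul Ur s1 s2 W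
  | DeltaShockB s beta => is_delta_shockB alpha kappa Ul Ur s beta
  | DeltaShockH s beta => is_delta_shockH alpha kappa Ul Ur s beta
  end.

(* A wave pattern starting from Ul is the list of its waves from left to right,
   each one paired with the constant state on its right. *)
Fixpoint connects (R : realType) (alpha kappa : R) (Ul : R * R)
    (ws : seq (wave R * (R * R))) (Ur : R * R) : Prop :=
  match ws with
  | [::] => Ul = Ur
  | (w, U) :: ws' => [/\ in_state_space U, is_wave alpha kappa Ul w U
                       & connects alpha kappa U ws' Ur]
  end.

(* Equality of two consecutive speeds is allowed: the waves are then attached
   and the constant state between them occupies no interval. *)
Definition wave_pattern (R : realType) (alpha kappa : R) (Ul : R * R)
    (ws : seq (wave R * (R * R))) (Ur : R * R) : Prop :=
  [/\ in_state_space Ul, connects alpha kappa Ul ws Ur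
    & sorted (fun w1 w2 : wave R => last_speed w1 <= first_speed w2)
             [seq p.1 | p <- ws]].

(* The absolutely continuous part of the solution as a function of xi = x / t.
   Its values at the finitely many jump speeds are immaterial. *)
Fixpoint profile (R : realType) (Ul : R * R) (ws : seq (wave R * (R * R)))
    (xi : R) : R * R :=
  match ws with
  | [::] => Ul
  | (w, U) :: ws' =>
      if xi < first_speed w then Ul
      else if xi < last_speed w then
        (if w is Rarefaction _ _ W then W xi else U)
      else profile U ws' xi
  end.

Definition density (R : realType) (Ul Ur : R * R)
    (ws : seq (wave R * (R * R))) (t x : R) : R * R :=
  if t == 0 then (if x < 0 then Ul else Ur) else profile Ul ws (x / t).

Definition singular_partH (R : realType) (w : wave R) (t : R) (A : set R)
    : \bar R :=
  if w is DeltaShockH s beta then ((beta t)%:E * \d_(s * t)%R A)%E else 0%E.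

Definition singular_partB (R : realType) (w : wave R) (t : R) (A : set R)
    : \bar R :=
  if w is DeltaShockB s beta then ((beta t)%:E * \d_(s * t)%R A)%E else 0%E.

(* Both components of all solutions considered here are nonnegative, hence pairs
   of nonnegative Borel measures represent their values in the space of
   R^2-valued Radon measures. *)
Definition measure2 (R : realType) : Type :=
  ({measure set (measurableTypeR R) -> \bar R} *
   {measure set (measurableTypeR R) -> \bar R})%type.

(* [U t] is the solution at time t of the Riemann problem with data Ul, Ur. *)
Definition riemann_solution (R : realType) (alpha kappa : R) (Ul Ur : R * R)
    (U : R -> measure2 R) : Prop :=
  exists2 ws : seq (wave R * (R * R)), wave_pattern alpha kappa Ul ws Ur &
  forall t : R, 0 <= t -> forall A : set (measurableTypeR R), measurable A ->
    (U t).1 A =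
      (\int[@lebesgue_measure R]_(x in A) ((density Ul Ur ws t x).1)%:E
       + \sum_(p <- ws) singular_partH p.1 t A)%E /\
    (U t).2 A =
      (\int[@lebesgue_measure R]_(x in A) ((density Ul Ur ws t x).2)%:E
       + \sum_(p <- ws) singular_partB p.1 t A)%E.

(* On the real line the Radon measures are the locally finite Borel measures. *)
Definition radon2 (R : realType) (mu : measure2 R) : Prop :=
  forall K : set R, compact K -> (mu.1 K < +oo)%E /\ (mu.2 K < +oo)%E.

Definition test_function (R : realType) (phi : R -> R) : Prop :=
  continuous phi /\ compact (closure [set x | phi x != 0]).

(* Convergence of mu_ k to mu in M_loc(R; R^2) along the filter F. *)
Definition Mloc_cvg (R : realType) (F : set_system R)
    (mu_ : R -> measure2 R) (mu : measure2 R) : Prop :=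
  [/\ \forall k \near F, radon2 (mu_ k),
      radon2 mu
    & forall phi : R -> R, test_function phi ->
        (\int[(mu_ k).1]_x (phi x)%:E @[k --> F] --> \int[mu.1]_x (phi x)%:E)%E
        /\
        (\int[(mu_ k).2]_x (phi x)%:E @[k --> F] --> \int[mu.2]_x (phi x)%:E)%E].

(* Main.v *)
From HB Require Import structures.
Require Import Defs.
From mathcomp Require Import all_boot all_order all_algebra.
From mathcomp Require Import all_classical all_reals all_analysis.
From mathcomp Require Import measurable_realfun ring lra.
Import Order.TTheory GRing.Theory Num.Theory.
Import numFieldNormedType.Exports.
Local Open Scope classical_set_scope.
Local Open Scope ring_scope.

(** Why the theorem holds.

    Write p and q for the values of lambda1 at the left and right data.  The
    wave pattern is unique as a measure, and it depends on the coefficients of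
    the system only through p and q ([wave_pattern_solved]).  Indeed a contact
    changes the state without changing lambda1, while shocks and rarefactions
    move along a ray b / h = const; on such a ray lambda1 is quadratic, so for
    q > 0 the state reached by the contact with speed p must be sqrt (p / q)
    times the right state.  Comparison of speeds leaves room for at most one
    further wave: a fan when p < q, a shock with speed p + sqrt (p q) + q when
    0 < q < p, and a delta shock with speed p when q = 0.  Since at most one of
    the four data vanishes, p and q are never both zero.

    In either limit p and q converge, so the theorem becomes the statement that
    the pairing of this explicit measure with a test function is a continuous
    function of (p, q) away from (0, 0) ([cvg_riemann_pairing_seq]).  If the
    limit of q is positive, the densities converge outside the two jumps and are
    bounded, and dominated convergence applies.  If q tends to 0, the middle
    state sqrt (p / q) V blows up on an interval of length t (sqrt (p q) + q);
    by the mean value theorem its contribution is (p + sqrt (p q)) t V times a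
    value of the test function on that interval ([riemann_pairing_shock]).  As
    q tends to 0 the interval shrinks to the point p t and the mass tends to
    p t V, which is exactly the mass of the delta shock. *)

(** * Explicit solution of the Riemann problem *)

(** The factor by which the right state is multiplied at xi = x / t, to the
    right of the contact.  The first branch is a fan, clamped to its two edges;
    the second is a shock.  For q = 0 and xi >= p the second branch is always 1:
    the interval of the middle state is empty, and its mass is [atom_mass]. *)
Definition fan_weight {R : realType} (p q xi : R) : R :=
  if p <= q then Num.sqrt (Num.min (Num.max xi (3 * p)) (3 * q) / (3 * q))
  else if xi < p + Num.sqrt (p * q) + q then Num.sqrt (p / q) else 1.

Definition riemann_profile {R : realType} (p q u v xi : R) : R :=
  if xi < p then u else fan_weight p q xi * v.

Definition atom_mass {R : realType} (p q v t : R) : R :=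
  if q == 0 then p * t * v else 0.

(** * Wave patterns are determined by their end states *)

Section Classification.
Context {R : realType}.
Variables (a k : R).
Hypotheses (a0 : 0 <= a) (k0 : 0 <= k).
Implicit Types (U V : R * R) (w : wave R) (ws : seq (wave R * (R * R))).
Local Notation l1 := (lambda1 a k).
Local Notation l2 := (lambda2 a k).
Local Notation consecutive :=
  (fun w1 w2 : wave R => last_speed w1 <= first_speed w2).

Definition ray (m : R) U : R * R := (m * U.1, m * U.2).

Lemma lambda1_scale m U : l1 (ray m U) = m ^+ 2 * l1 U.
Proof. by rewrite /lambda1 /=; ring. Qed.

Lemma lambda1_ge0 U : in_state_space U -> 0 <= l1 U.
Proof.
by move=> [h0 b0]; rewrite addr_ge0// ?divr_ge0 ?mulr_ge0 ?sqr_ge0.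
Qed.

Lemma state_eq0 U : U.1 = 0 -> U.2 = 0 -> U = (0, 0).
Proof. by case: U => h b /= -> ->. Qed.

Lemma lambda1_0 : l1 (0, 0) = 0.
Proof. by rewrite /lambda1 /=; ring. Qed.

(** The jump conditions read U_r (lambda_r - s) = U_l (lambda_l - s), so the two
    states are parallel; cancelling m - 1 gives the speed, and the entropy
    conditions then say that 0 < m < 1. *)
Lemma shock_ray Ul Ur s : in_state_space Ul -> in_state_space Ur ->
  is_shock a k Ul Ur s ->
  exists m, [/\ 0 < m, m < 1, Ur = ray m Ul, 0 < l1 Ul
    & s = l1 Ul * (1 + m + m ^+ 2)].
Proof.
move=> [hl0 bl0] [hr0 br0] [rh1 rh2 /andP[rs sl] ls].
have l0 : 0 < l1 Ul by rewrite /lambda2 in sl; lra.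
have srN0 : s - l1 Ur != 0.
  apply/negP => /eqP sr.
  have e1 : Ul.1 * (s - l1 Ul) = 0.
    by have lr : l1 Ur = s; [lra | rewrite lr in rh1; lra].
  have e2 : Ul.2 * (s - l1 Ul) = 0.
    by have lr : l1 Ur = s; [lra | rewrite lr in rh2; lra].
  have sl0 : s - l1 Ul != 0 by rewrite subr_eq0 gt_eqF.
  move/eqP: e1; rewrite mulf_eq0 (negPf sl0) orbF => /eqP e1.
  move/eqP: e2; rewrite mulf_eq0 (negPf sl0) orbF => /eqP e2.
  by move: l0; rewrite (state_eq0 _ e1 e2) lambda1_0 ltxx.
pose m := (s - l1 Ul) / (s - l1 Ur).
have Urm : Ur = ray m Ul.
  rewrite [LHS]surjective_pairing /m; congr (_, _).
    apply: (mulIf srN0); rewrite mulrAC divfK//; lra.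
  apply: (mulIf srN0); rewrite mulrAC divfK//; lra.
have lr : l1 Ur = m ^+ 2 * l1 Ul by rewrite Urm lambda1_scale.
have ms : m * (s - m ^+ 2 * l1 Ul) = s - l1 Ul by rewrite -lr /m divfK.
have m0 : 0 < m.
  rewrite /m divr_gt0 ?subr_gt0//.
  have := @lambda1_ge0 Ur (conj hr0 br0).
  rewrite /lambda2 in rs; lra.
have m1 : m != 1.
  apply/negP => /eqP m1; rewrite m1 in lr; rewrite /lambda2 in rs sl.
  by move: rs sl; rewrite lr; lra.
have sE : s = l1 Ul * (1 + m + m ^+ 2).
  apply: (@mulIf _ (1 - m)); first by rewrite subr_eq0 eq_sym.
  by move: ms; nra.
exists m; split => //.
rewrite ltNge; apply/negP => m1'; rewrite /lambda2 in sl.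
move: sl; rewrite sE; nra.
Qed.


(** On a ray b = c h, lambda1 is a multiple of h ^ 2, so prescribing
    lambda2 = xi leaves one nonnegative h. *)
Lemma rarefaction_ray Ul Ur s1 s2 W : in_state_space Ul -> in_state_space Ur ->
  is_rarefaction a k Ul Ur s1 s2 W ->
  [/\ l1 Ul < l1 Ur, 0 < l1 Ur & forall xi, s1 <= xi <= s2 ->
    W xi = ray (Num.sqrt (xi / l2 Ur)) Ur].
Proof.
move=> Ul0 [hr0 br0] [[s1E s2E s12] [W1 W2] _ [c c0 Wray] Wmono].
have ll0 := lambda1_ge0 Ul Ul0.
have lt : l1 Ul < l1 Ur by move: s12; rewrite s1E s2E /lambda2; lra.
have lr0 : 0 < l1 Ur by lra.
split=> // xi /andP[xi1 xi2].
have /Wray[Wr Wl] : s1 <= xi <= s2 by rewrite xi1 xi2.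
have /Wray[Rr Rl] : s1 <= s2 <= s2 by rewrite lexx (ltW s12).
rewrite W2 in Rr Rl.
have [Wh _] := Wmono s1 xi (lexx s1) xi1 xi2.
have Wh0 : 0 <= (W xi).1 by apply: le_trans Wh; rewrite W1; case: Ul0.
have lE V : V.2 = c * V.1 -> l1 V = (a * c + k / 3) * V.1 ^+ 2.
  by rewrite /lambda1 => ->; ring.
have hN0 : Ur.1 != 0.
  by apply/negP => /eqP h0; move: lr0; rewrite lE// h0 expr0n mulr0 ltxx.
have dN0 : a * c + k / 3 != 0.
  by apply/negP => /eqP d0; move: lr0; rewrite lE// d0 mul0r ltxx.
have sq : (W xi).1 ^+ 2 = xi / l2 Ur * Ur.1 ^+ 2.
  rewrite -{2}Wl /lambda2 !lE//; field.
  by rewrite hN0; apply: contra dN0 => /eqP e; apply/eqP; lra.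
have xi0 : 0 <= xi / l2 Ur.
  rewrite divr_ge0// /lambda2; last lra.
  by rewrite (le_trans _ xi1)// s1E /lambda2; lra.
have hE : (W xi).1 = Num.sqrt (xi / l2 Ur) * Ur.1.
  by rewrite -[LHS]ger0_norm// -sqrtr_sqr sq sqrtrM// sqrtr_sqr ger0_norm.
by rewrite [LHS]surjective_pairing Wr hE /ray Rr; congr (_, _); ring.
Qed.

(** This is why nothing follows a shock or a delta shock: these move faster than
    lambda2 of the state on their right. *)
Lemma first_speed_le Ul w Ur : in_state_space Ul -> is_wave a k Ul w Ur ->
  first_speed w <= l2 Ul.
Proof.
move=> /lambda1_ge0 l0; rewrite /lambda2; case: w => [s|s|s1 s2 W|s b|s b] /=.
- by move=> [-> _]; lra.
- by move=> [_ _ /andP[_ /ltW]].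
- by move=> [[-> _ _] _ _ _ _]; rewrite /lambda2.
- by move=> [_ _ _ [_ _ -> _]]; lra.
- by move=> [_ _ _ [_ _ -> _]]; lra.
Qed.

Lemma no_wave_beyond U ws V s : in_state_space U -> connects a k U ws V ->
  path consecutive (Contact s) [seq p.1 | p <- ws] -> l2 U < s -> ws = [::].
Proof.
case: ws => [//|[w Ur] ws] U0 /= [_ /(first_speed_le _ _ _ U0) fw _] /andP[sf _] ls.
by move: (lt_le_trans ls (le_trans sf fw)); rewrite ltxx.
Qed.

Lemma path_contact w (ws : seq (wave R)) : path consecutive w ws ->
  path consecutive (Contact (last_speed w)) ws.
Proof. by case: ws. Qed.

Lemma ray_rescale Ur V : 0 < l1 Ur -> 0 < l1 V ->
  Ur = ray (Num.sqrt (l1 Ur / l1 V)) V -> forall x, 0 <= x ->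
  ray (Num.sqrt (x / l2 Ur)) Ur = ray (Num.sqrt (x / l2 V)) V.
Proof.
move=> lr0 V0 UrE x x0; rewrite {2}UrE /ray /= !mulrA -sqrtrM; last first.
  by rewrite divr_ge0 // /lambda2; lra.
have -> // : x / l2 Ur * (l1 Ur / l1 V) = x / l2 V.
by rewrite /lambda2; field; rewrite !gt_eqF.
Qed.

(** A wave that leaves a state with lambda1 > 0 at speed lambda2 or more is a
    rarefaction, all other waves being slower.  Several attached rarefactions may
    follow each other, but they lie on the same ray and form a single fan.  The
    contact in the hypothesis encodes the lower bound on the first speed. *)
Lemma rarefaction_chain U ws V : in_state_space U -> connects a k U ws V ->
  path consecutive (Contact (l2 U)) [seq p.1 | p <- ws] -> 0 < l1 U ->
  [/\ l1 U <= l1 V, U = ray (Num.sqrt (l1 U / l1 V)) V,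
      (forall xi, l2 U <= xi ->
         profile U ws xi = ray (Num.sqrt (Num.min xi (l2 V) / l2 V)) V)
    & forall t A, (\sum_(p <- ws) singular_partH p.1 t A = 0 /\
                   \sum_(p <- ws) singular_partB p.1 t A = 0)%E].
Proof.
elim: ws U => [|[w Ur] ws IH] U U0.
  move=> /= <- _ l0; have l0' : l2 U != 0 by rewrite /lambda2; lra.
  have U1 : U = ray 1 U by rewrite /ray !mul1r -surjective_pairing.
  split=> //.
  - by rewrite divff ?gt_eqF// sqrtr1.
  - by move=> xi xi1; rewrite min_r// divff// sqrtr1.
  - by move=> t A; rewrite !big_nil.
move=> /= [Ur0 iw cw] /andP[fw pw] l0.
case: w iw fw pw => [s|s|s1 s2 W|s b|s b] /=.
- by move=> [-> _]; rewrite /lambda2; lra.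
- by move=> [_ _ /andP[_ ls] _]; lra.
- move=> iw _ pw; have [[s1E s2E s12] [W1 W2] _ _ _] := iw.
  have [lt lr0 WE] := rarefaction_ray _ _ _ _ _ U0 Ur0 iw.
  have /path_contact/= := pw; rewrite s2E => {}pw.
  have [leV UrE prof sing] := IH Ur Ur0 cw pw lr0.
  have V0 : 0 < l1 V by lra.
  have rayM := ray_rescale _ _ lr0 V0 UrE.
  split.
  + lra.
  + rewrite -{1}W1 WE ?lexx ?(ltW s12)// rayM; last by rewrite s1E /lambda2; lra.
    congr (ray (Num.sqrt _) _); rewrite s1E /lambda2; field.
    by rewrite gt_eqF.
  + move=> xi xi1; rewrite s1E ltNge xi1 /=; case: ltP => xi2; last exact: prof.
    rewrite WE ?s1E ?s2E ?xi1 ?(ltW xi2)// rayM; last first.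
      by rewrite (le_trans _ xi1)// /lambda2; lra.
    by rewrite min_l// (le_trans (ltW xi2))// /lambda2; lra.
  + by move=> t A; rewrite !big_cons /= !add0e; exact: sing.
- by move=> [_ _ _ [_ _ -> lt]]; lra.
- by move=> [_ _ _ [_ _ -> lt]]; lra.
Qed.

Lemma delta_massE (beta : R -> R) (c t : R) :
  delta_mass beta c -> 0 <= t -> beta t = c * t.
Proof.
move=> [b0 bc bd]; rewrite le_eqVlt => /predU1P[<-|t0]; first by rewrite b0 mulr0.
have [||x _] := @MVT R beta (fun=> c) 0 t t0.
- by move=> x; rewrite in_itv/= => /andP[x0 _]; exact: bd.
- apply: continuous_subspaceW bc => x /=; rewrite !in_itv/= => /andP[-> _] //.
- by rewrite b0 !subr0.
Qed.

Lemma connects_nil U V : connects a k U [::] V -> V = U.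
Proof. by move=> /= ->. Qed.

(** Uniqueness of the Riemann solution.  Induction on the waves: contacts keep
    lambda1, hence all travel at the same speed; the first wave that is not a
    contact is a shock or a delta shock, after which nothing can follow, or a
    rarefaction, after which only rarefactions follow. *)
Lemma wave_pattern_solved U ws V : wave_pattern a k U ws V ->
  0 < l1 U \/ 0 < l1 V ->
  (forall xi, profile U ws xi =
    (riemann_profile (l1 U) (l1 V) U.1 V.1 xi,
     riemann_profile (l1 U) (l1 V) U.2 V.2 xi)) /\
  (forall t, 0 <= t -> forall A,
    (\sum_(p <- ws) singular_partH p.1 t A =
       (atom_mass (l1 U) (l1 V) V.1 t)%:E * \d_(l1 U * t)%R A /\
     \sum_(p <- ws) singular_partB p.1 t A =
       (atom_mass (l1 U) (l1 V) V.2 t)%:E * \d_(l1 U * t)%R A)%E).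
Proof.
move=> [U0 cn so] l0; elim: ws U U0 cn so l0 => [|[w Ur] ws IH] U U0.
  move=> /connects_nil-> _ l0.
  have {}l0 : 0 < l1 U by case: l0.
  split=> [xi|t t0 A].
    rewrite /riemann_profile /fan_weight lexx; case: ltP => xi1 /=.
      by rewrite -surjective_pairing.
    rewrite (_ : Num.min _ _ = 3 * l1 U); last first.
      by rewrite min_r// le_max lexx orbT.
    by rewrite divff ?sqrtr1 ?mul1r -?surjective_pairing//; lra.
  by rewrite !big_nil /atom_mass gt_eqF// !mul0e.
move=> [Ur0 iw cw] so l0.
case: w iw so => [s|s|s1 s2 W|s b|s b] /=.
- move=> [sl sr] pw; have lE : l1 Ur = l1 U by rewrite -sl.
  have [] := IH Ur Ur0 cw (path_sorted pw); first by rewrite lE.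
  rewrite lE => prof sing; split=> [xi|t t0 A]; last first.
    by rewrite !big_cons /= !add0e; exact: sing.
  rewrite sl prof /riemann_profile; case: ltP => //.
  by rewrite -surjective_pairing.
- move=> iw /path_contact/= pw; have [m [m0 m1 UrE lU sE]] := shock_ray _ _ _ U0 Ur0 iw.
  have [_ _ /andP[ls _] lUs] := iw.
  have ws0 := no_wave_beyond _ _ _ _ Ur0 cw pw ls.
  rewrite ws0 in cw *; have VE := connects_nil _ _ cw.
  have lV : l1 V = m ^+ 2 * l1 U by rewrite VE UrE lambda1_scale.
  have ltV : l1 V < l1 U by rewrite lV; nra.
  have lV0 : 0 < l1 V by rewrite lV mulr_gt0// exprn_gt0.
  have root1 : Num.sqrt (l1 U * l1 V) = m * l1 U.
    rewrite lV (_ : l1 U * _ = (m * l1 U) ^+ 2); last by ring.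
    by rewrite sqrtr_sqr ger0_norm// mulr_ge0// ltW.
  have root2 : Num.sqrt (l1 U / l1 V) = m^-1.
    rewrite lV (_ : _ / _ = m^-1 ^+ 2); last by field; rewrite !gt_eqF.
    by rewrite sqrtr_sqr ger0_norm// invr_ge0 ltW.
  have sE' : s = l1 U + m * l1 U + l1 V by rewrite sE lV; ring.
  split=> [xi|t t0 A]; last first.
    by rewrite !big_cons !big_nil /= !add0e /atom_mass gt_eqF// !mul0e.
  rewrite /riemann_profile /fan_weight leNgt ltV /= root1 root2 -sE'.
  rewrite VE UrE /ray /=; case: (ltP xi s) => xis.
    by rewrite !mulKf ?gt_eqF// !if_same -surjective_pairing.
  have -> : (xi < l1 U) = false; last by rewrite !mul1r.
  by apply/negbTE; rewrite -leNgt (le_trans (ltW lUs)).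
- move=> iw pw; have [[s1E s2E s12] [W1 W2] _ _ _] := iw.
  have [lt lr0 WE] := rarefaction_ray _ _ _ _ _ U0 Ur0 iw.
  move: pw => /path_contact/= pw; rewrite s2E in pw.
  have [leV UrE prof sing] := rarefaction_chain _ _ _ Ur0 cw pw lr0.
  have lU0 := lambda1_ge0 _ U0.
  have V0 : 0 < l1 V by lra.
  have rayM := ray_rescale _ _ lr0 V0 UrE.
  split=> [xi|t t0 A]; last first.
    rewrite !big_cons /= !add0e /atom_mass gt_eqF// !mul0e; exact: sing.
  rewrite /riemann_profile /fan_weight (_ : l1 U <= l1 V); last lra.
  have UE : U = ray (Num.sqrt (l2 U / l2 V)) V.
    rewrite -{1}W1 WE ?lexx ?(ltW s12)// s1E rayM// /lambda2; lra.
  have leV3 : 3 * l1 U <= 3 * l1 V by lra.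
  case: (ltP xi (l1 U)) => xi0.
    by rewrite ifT -?surjective_pairing// s1E /lambda2; lra.
  case: (ltP xi s1) => xi1.
    rewrite max_r; last by rewrite -/(l2 U) -s1E ltW.
    by rewrite min_l// {1}UE.
  rewrite max_l; last by rewrite -/(l2 U) -s1E.
  case: (ltP xi s2) => xi2.
    rewrite WE ?xi1 ?(ltW xi2)// rayM; last by lra.
    by rewrite min_l// (le_trans (ltW xi2))// s2E /lambda2; lra.
  by rewrite prof -?s2E.
- move=> [h0 _ dm [lr0 _ sE lt]] /path_contact/= pw.
  have lU0 : 0 < l1 U by move: lt; rewrite /lambda2; lra.
  have ws0 : ws = [::].
    by apply: (no_wave_beyond _ _ _ _ Ur0 cw pw); rewrite /lambda2 -lr0 sE; lra.
  rewrite ws0 in cw *; have VE := connects_nil _ _ cw.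
  rewrite VE -lr0 sE; split=> [xi|t t0 A].
    rewrite /riemann_profile /fan_weight leNgt lU0 /= mulr0 sqrtr0 !addr0.
    by case: ltP => _; rewrite -?surjective_pairing// !mul1r -surjective_pairing.
  rewrite !big_cons !big_nil /= /atom_mass eqxx h0 mulr0 mul0e !adde0; split=> //.
  rewrite (delta_massE _ _ _ dm t0) sE -lr0; congr ((_)%:E * _)%E; ring.
- move=> [h0 _ dm [lr0 _ sE lt]] /path_contact/= pw.
  have lU0 : 0 < l1 U by move: lt; rewrite /lambda2; lra.
  have ws0 : ws = [::].
    by apply: (no_wave_beyond _ _ _ _ Ur0 cw pw); rewrite /lambda2 -lr0 sE; lra.
  rewrite ws0 in cw *; have VE := connects_nil _ _ cw.
  rewrite VE -lr0 sE; split=> [xi|t t0 A].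
    rewrite /riemann_profile /fan_weight leNgt lU0 /= mulr0 sqrtr0 !addr0.
    by case: ltP => _; rewrite -?surjective_pairing// !mul1r -surjective_pairing.
  rewrite !big_cons !big_nil /= /atom_mass eqxx h0 mulr0 mul0e !adde0; split=> //.
  rewrite (delta_massE _ _ _ dm t0) sE -lr0; congr ((_)%:E * _)%E; ring.
Qed.

End Classification.

(** * Measures with a density and an atom *)

Section DensityMeasure.
Context {d : measure_display} {T : measurableType d} {R : realType}.
Variable mu : {measure set T -> \bar R}.
Local Open Scope ereal_scope.
Import HBNNSimple.

(** The defining identity on sets extends to nonnegative functions by monotone
    convergence along simple functions. *)
Lemma integral_density (nu : {measure set T -> \bar R}) (f : T -> R) (g : T -> \bar R) :
  measurable_fun setT f -> (forall x, 0 <= f x)%R ->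
  (forall A, measurable A -> nu A = \int[mu]_(x in A) (f x)%:E) ->
  measurable_fun setT g -> (forall x, 0 <= g x) ->
  \int[nu]_x g x = \int[mu]_x (g x * (f x)%:E).
Proof.
move=> /measurable_EFinP mf f0 nuE mg g0; pose h := nnsfun_approx measurableT mg.
have nd_h x : {homo (fun n => (h n x)%:E) : n m / (n <= m)%N >-> n <= m}.
  by move=> n m nm; rewrite lee_fin; exact/lefP/nd_nnsfun_approx.
have cvg_h x : (h n x)%:E @[n --> \oo] --> g x.
  exact: (cvg_nnsfun_approx measurableT mg (fun x _ => g0 x)).
have mh n : measurable_fun setT (fun x => (h n x)%:E).
  exact/measurable_EFinP.
transitivity (limn (fun n => \int[nu]_x (h n x)%:E)).
  rewrite -monotone_convergence//.
  - by apply: eq_integral => x _; apply/esym/cvg_lim.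
  - by move=> n x _; rewrite lee_fin.
transitivity (limn (fun n => \int[mu]_x ((h n x)%:E * (f x)%:E))); last first.
  rewrite -monotone_convergence//.
  - apply: eq_integral => x _; apply/cvg_lim => //.
    by apply: cvgeZr => //; exact: cvg_h.
  - by move=> n; apply: emeasurable_funM.
  - by move=> n x _; rewrite mule_ge0 ?lee_fin.
  - by move=> x _ n m nm; apply: lee_wpmul2r; rewrite ?lee_fin//; exact: nd_h.
congr (limn _); apply/funext => n.
have ind_ge0 r x : 0 <= (r * \1_(h n @^-1` [set r]) x)%:E.
  by rewrite EFinM nnfun_muleindic_ge0.
have mind r : measurable_fun setT (fun x => (r * \1_(h n @^-1` [set r]) x)%:E).
  by apply/measurable_EFinP; exact: measurable_funM.
transitivity (\int[nu]_x \sum_(r \in range (h n)) (r * \1_(h n @^-1` [set r]) x)%:E).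
  by apply: eq_integral => x _; rewrite fimfunE -fsumEFin.
rewrite ge0_integral_fsum//.
transitivity (\int[mu]_x \sum_(r \in range (h n))
    ((r * \1_(h n @^-1` [set r]) x)%:E * (f x)%:E)); last first.
  apply: eq_integral => x _.
  by rewrite -ge0_mule_fsuml ?lee_fin// fsumEFin// -fimfunE.
rewrite ge0_integral_fsum//; last 2 first.
- by move=> r; exact: emeasurable_funM.
- by move=> r x _; apply: mule_ge0; [exact: ind_ge0|rewrite lee_fin].
apply: eq_fsbigr => r _.
under eq_integral do rewrite EFinM.
rewrite integralZl_indic_nnsfun//.
under [RHS]eq_integral do rewrite EFinM -muleA.
have mA : measurable (h n @^-1` [set r]) by exact: measurable_sfunP.
rewrite integral_indic// setIT nuE//.
have [r0|r0] := leP 0%R r.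
  rewrite ge0_integralZl//.
  - congr (_ * _).
    rewrite [RHS](_ : _ = \int[mu]_x (((EFin \o f) \_ (h n @^-1` [set r])) x)).
      by rewrite -integral_mkcond.
    apply: eq_integral => x _; rewrite patchE indicE; case: ifP => _.
      by rewrite mul1e.
    by rewrite mul0e.
  - by apply: emeasurable_funM => //; exact/measurable_EFinP.
  - by move=> x _; rewrite mule_ge0 // lee_fin.
have -> : h n @^-1` [set r] = set0.
  apply/seteqP; split => x //= hr; have : (0 <= h n x)%R by [].
  by rewrite hr leNgt r0.
rewrite integral_set0 mule0 integral0_eq// => x _.
by rewrite indic0 mul0e mule0.
Qed.


Definition density_measure (f : T -> R) (mf : measurable_fun setT f)
  (f0 : forall x, (0 <= f x)%R) (A : set T) : \bar R := \int[mu]_(x in A) (f x)%:E.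

Variables (f : T -> R) (mf : measurable_fun setT f) (f0 : forall x, (0 <= f x)%R).
Local Notation nu := (density_measure f mf f0).

Let nu0 : nu set0 = 0. Proof. exact: integral_set0. Qed.

Let nu_ge0 A : 0 <= nu A.
Proof. by apply: integral_ge0 => x _; rewrite lee_fin. Qed.

Let nu_sigma_additive : semi_sigma_additive nu.
Proof. by apply: semi_sigma_additive_nng_induced => //; exact/measurable_EFinP. Qed.

HB.instance Definition _ := isMeasure.Build _ _ _ nu nu0 nu_ge0 nu_sigma_additive.

Lemma integral_density_atom (nu' : {measure set T -> \bar R}) (c : R) (y : T)
    (g : T -> R) : (0 <= c)%R ->
  (forall A, measurable A ->
     nu' A = \int[mu]_(x in A) (f x)%:E + c%:E * \d_y A) ->
  measurable_fun setT g -> (forall x, (0 <= g x)%R) ->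
  \int[nu']_x (g x)%:E = \int[mu]_x (g x * f x)%:E + (c * g y)%:E.
Proof.
move=> c0 nuE mg g0.
have mge : measurable_fun setT (EFin \o g) by exact/measurable_EFinP.
have ge0 x : 0 <= (g x)%:E by rewrite lee_fin.
have ge0T x : [set: T] x -> 0 <= (g x)%:E by [].
rewrite (eq_measure_integral (measure_add nu (mscale (NngNum c0) \d_y))).
  rewrite ge0_integral_measure_add// ge0_integral_mscale// integral_dirac//.
  rewrite diracT mul1e -EFinM; congr (_ + _).
  by apply: (integral_density nu f) => //.
by move=> A mA _; rewrite nuE//; apply/esym; exact: measure_addE.
Qed.

End DensityMeasure.

(** * Dependence of the profile on the two characteristic speeds *)

Section FanWeight.
Context {R : realType}.
Implicit Types p q u v xi : R.

Lemma fan_weight_ge0 p q xi : 0 <= fan_weight p q xi.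
Proof.
by rewrite /fan_weight; case: ifP => // _; case: ifP.
Qed.

Lemma fan_weight_le p q xi : 0 <= p -> 0 <= q ->
  fan_weight p q xi <= 1 + Num.sqrt (p / q).
Proof.
move=> p0 q0; rewrite /fan_weight; case: ifP => _; last first.
  by case: ifP => _; rewrite ?lerDr ?lerDl ?sqrtr_ge0.
rewrite (@le_trans _ _ 1)// ?lerDl ?sqrtr_ge0// -[leRHS]sqrtr1 ler_wsqrtr//.
move: q0; rewrite le_eqVlt => /predU1P[<-|q0]; first by rewrite mulr0 invr0 mulr0.
by rewrite ler_pdivrMr ?mulr_gt0// mul1r ge_min lexx orbT.
Qed.

Lemma measurable_fan_weight p q : measurable_fun [set: R] (fan_weight p q).
Proof.
rewrite /fan_weight; case: (p <= q).
  apply: (measurableT_comp (f := @Num.sqrt R)).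
    apply: continuous_measurable_fun; apply: sqrt_continuous.
  apply: measurable_funM => //; apply: measurable_minr => //.
  exact: measurable_maxr.
by apply: measurable_fun_ifT => //; exact: measurable_fun_ltr.
Qed.

Lemma riemann_profile_ge0 p q u v xi : 0 <= u -> 0 <= v ->
  0 <= riemann_profile p q u v xi.
Proof.
by move=> u0 v0; rewrite /riemann_profile; case: ifP => // _; rewrite mulr_ge0 ?fan_weight_ge0.
Qed.

Lemma riemann_profile_le p q u v xi : 0 <= p -> 0 <= q -> 0 <= u -> 0 <= v ->
  riemann_profile p q u v xi <= u + (1 + Num.sqrt (p / q)) * v.
Proof.
move=> p0 q0 u0 v0; rewrite /riemann_profile; case: ifP => _.
  by rewrite lerDl mulr_ge0// addr_ge0 ?sqrtr_ge0.
by rewrite (le_trans (ler_wpM2r v0 (fan_weight_le _ _ xi p0 q0)))// lerDr.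
Qed.

Lemma measurable_riemann_profile p q u v :
  measurable_fun [set: R] (riemann_profile p q u v).
Proof.
apply: measurable_fun_ifT => //; first exact: measurable_fun_ltr.
by apply: measurable_funM => //; exact: measurable_fan_weight.
Qed.

Section Limit.
Context {I : Type} {F : set_system I} {FF : ProperFilter F}.
Implicit Types f g : I -> R.

Lemma cvg_if (b : I -> bool) f g (l : R) : f @ F --> l -> g @ F --> l ->
  (if b k then f k else g k) @[k --> F] --> l.
Proof.
move=> /cvgrPdist_lt fl /cvgrPdist_lt gl; apply/cvgrPdist_lt => e e0.
by near=> k; case: ifP => _; near: k; [exact: fl|exact: gl].
Unshelve. all: by end_near. Qed.

Lemma cvg_maxr f g (l m : R) : f @ F --> l -> g @ F --> m ->
  Num.max (f k) (g k) @[k --> F] --> Num.max l m.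
Proof.
move=> fl gm; under eq_fun do rewrite maxr_absE.
rewrite maxr_absE; apply: cvgM; [|exact: cvg_cst]; apply: cvgD; first exact: cvgD.
by apply: cvg_norm; apply: cvgB.
Qed.

Lemma cvg_minr f g (l m : R) : f @ F --> l -> g @ F --> m ->
  Num.min (f k) (g k) @[k --> F] --> Num.min l m.
Proof.
move=> fl gm; under eq_fun do rewrite minr_absE.
rewrite minr_absE; apply: cvgM; [|exact: cvg_cst]; apply: cvgB; first exact: cvgD.
by apply: cvg_norm; apply: cvgB.
Qed.

Lemma cvg_sqrt f (l : R) : f @ F --> l ->
  Num.sqrt (f k) @[k --> F] --> Num.sqrt l.
Proof. by move=> fl; apply: continuous_cvg => //; exact: sqrt_continuous. Qed.

Lemma cvg_lt_if f (l : R) g h xi (m n : R) : f @ F --> l -> xi != l ->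
  g @ F --> m -> h @ F --> n ->
  (if xi < f k then g k else h k) @[k --> F] --> (if xi < l then m else n).
Proof.
move=> fl; rewrite neq_lt => /orP[xl|lx] gm hn.
  rewrite xl; apply: cvg_trans gm; apply: near_eq_cvg.
  by near do rewrite ifT//; exact: cvgr_gt fl _ xl.
rewrite ltNge (ltW lx) /=; apply: cvg_trans hn; apply: near_eq_cvg.
near=> k; rewrite ifF//; apply/negbTE; rewrite -leNgt ltW//.
by near: k; exact: cvgr_lt fl _ lx.
Unshelve. all: by end_near. Qed.

Lemma cvg_shock_speed (p_ q_ : I -> R) p q : p_ @ F --> p -> q_ @ F --> q ->
  p_ k + Num.sqrt (p_ k * q_ k) + q_ k @[k --> F] --> p + Num.sqrt (p * q) + q.
Proof.
by move=> pp qq; apply: cvgD => //; apply: cvgD => //; apply: cvg_sqrt; apply: cvgM.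
Qed.

(** The fan and the shock formula are continuous separately, and for p = q, when
    both branches may occur along F, they have the same limit 1. *)
Lemma cvg_fan_weight (p_ q_ : I -> R) p q xi : p_ @ F --> p -> q_ @ F --> q ->
  0 <= p -> 0 < q -> xi != p + Num.sqrt (p * q) + q ->
  fan_weight (p_ k) (q_ k) xi @[k --> F] --> fan_weight p q xi.
Proof.
move=> pp qq p0 q0 xis.
have cA : Num.sqrt (Num.min (Num.max xi (3 * p_ k)) (3 * q_ k) / (3 * q_ k))
    @[k --> F] --> Num.sqrt (Num.min (Num.max xi (3 * p)) (3 * q) / (3 * q)).
  have q3 : 3 * q_ k @[k --> F] --> 3 * q by apply: cvgM => //; exact: cvg_cst.
  apply: cvg_sqrt; apply: cvgM.
    apply: cvg_minr => //; apply: cvg_maxr; first exact: cvg_cst.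
    by apply: cvgM => //; exact: cvg_cst.
  by apply: cvgV => //; rewrite mulf_neq0// gt_eqF.
have cB : (if xi < p_ k + Num.sqrt (p_ k * q_ k) + q_ k
    then Num.sqrt (p_ k / q_ k) else 1)
    @[k --> F] --> (if xi < p + Num.sqrt (p * q) + q then Num.sqrt (p / q) else 1).
  apply: cvg_lt_if => //; [exact: cvg_shock_speed| |exact: cvg_cst].
  by apply: cvg_sqrt; apply: cvgM => //; apply: cvgV => //; rewrite gt_eqF.
rewrite {2}/fan_weight; have [pq|qp|pq] := ltgtP p q.
- apply: cvg_trans cA; apply: near_eq_cvg; near=> k; rewrite /fan_weight ifT//.
  rewrite ltW// -subr_gt0; near: k.
  have /cvgr_gt : q_ k - p_ k @[k --> F] --> q - p by apply: cvgB.
  by apply; rewrite subr_gt0.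
- apply: cvg_trans cB; apply: near_eq_cvg; near=> k; rewrite /fan_weight leNgt.
  rewrite (_ : q_ k < p_ k)//; rewrite -subr_gt0; near: k.
  have /cvgr_gt : p_ k - q_ k @[k --> F] --> p - q by apply: cvgB.
  by apply; rewrite subr_gt0.
- rewrite pq in cA cB *; have q30 : 3 * q != 0 by rewrite mulf_neq0// gt_eqF.
  have e : Num.min (Num.max xi (3 * q)) (3 * q) = 3 * q.
    by rewrite min_r// le_max lexx orbT.
  rewrite e divff// sqrtr1 in cA *.
  by rewrite divff ?gt_eqF// sqrtr1 if_same in cB; apply: cvg_if.
Unshelve. all: by end_near. Qed.

Lemma cvg_riemann_profile (p_ q_ : I -> R) p q u v xi :
  p_ @ F --> p -> q_ @ F --> q -> 0 <= p -> 0 < q ->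
  xi != p -> xi != p + Num.sqrt (p * q) + q ->
  riemann_profile (p_ k) (q_ k) u v xi @[k --> F] --> riemann_profile p q u v xi.
Proof.
move=> pp qq p0 q0 xip xis; apply: cvg_lt_if => //; first exact: cvg_cst.
by apply: cvgM; [exact: cvg_fan_weight|exact: cvg_cst].
Qed.

End Limit.
End FanWeight.

(** * Continuity of the pairing with a test function *)

Definition riemann_density {R : realType} (p q u v t x : R) : R :=
  if t == 0 then (if x < 0 then u else v) else riemann_profile p q u v (x / t).

Section Functional.
Context {R : realType}.
Local Notation mu := (@lebesgue_measure R).
Variable phi : R -> R.
Hypotheses (phi_test : test_function phi) (phi0 : forall x, 0 <= phi x).

Let phi_cont : continuous phi. Proof. by case: phi_test. Qed.

Lemma measurable_test : measurable_fun [set: R] phi.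
Proof. exact: continuous_measurable_fun. Qed.

Lemma integrable_test : mu.-integrable setT (EFin \o phi).
Proof.
have [_ cK] := phi_test; set K := closure _ in cK.
have mK : measurable K by exact: compact_measurable.
have iK : mu.-integrable K (EFin \o phi).
  by apply: continuous_compact_integrable => //; exact: continuous_subspaceT.
rewrite (_ : EFin \o phi = (EFin \o phi) \_ K).
  exact: (integrable_mkcond (mu := mu) (EFin \o phi) mK).1 iK.
apply/funext => x; rewrite patchE; case: ifPn => // /negP xK /=.
have [->//|phiN0] := eqVneq (phi x) 0.
by exfalso; apply: xK; rewrite inE; apply: subset_closure.
Qed.

Lemma integrable_test_bounded (G : R -> R) (M : R) : measurable_fun setT G ->
  (forall x, `|G x| <= M) ->
  mu.-integrable setT (EFin \o (fun x => phi x * G x)).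
Proof.
move=> mG GM; apply: (@integrableMl _ _ _ mu setT measurableT (EFin \o phi) G) => //.
  exact: integrable_test.
exists M; split; first exact: num_real.
by move=> N MN x _; exact: le_trans (GM x) (ltW MN).
Qed.

Lemma cvg_integral_test (G_ : nat -> R -> R) (G : R -> R) (M a b : R) :
  (forall n, measurable_fun setT (G_ n)) -> measurable_fun setT G ->
  (forall n x, `|G_ n x| <= M) ->
  (forall x, x != a -> x != b -> G_ n x @[n --> \oo] --> G x) ->
  (\int[mu]_x (phi x * G_ n x))%R @[n --> \oo] --> (\int[mu]_x (phi x * G x))%R.
Proof.
move=> mG_ mG GM GG.
have [|||||iG _ cG] := @dominated_convergence _ _ _ mu setT measurableT
  (fun n => EFin \o (fun x => phi x * G_ n x)) (EFin \o (fun x => phi x * G x))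
  (EFin \o (fun x => phi x * M)).
- by move=> n; apply/measurable_EFinP/measurable_funM; [exact: measurable_test|exact: mG_].
- by apply/measurable_EFinP/measurable_funM; [exact: measurable_test|].
- have : mu.-negligible ([set a] `|` [set b]).
    by apply: negligibleU; apply/negligibleP => //; exact: lebesgue_measure_set1.
  apply: negligibleS => x /=; apply: contraPP => /not_orP[/eqP xa /eqP xb].
  rewrite notE => _; apply: cvg_EFin; first exact: nearW.
  by apply: cvgM; [exact: cvg_cst|exact: GG].
- by apply: (integrable_test_bounded (cst M) `|M|) => // x.
- apply: aeW => x n _ /=; rewrite lee_fin normrM (ger0_norm (phi0 x)).
  by rewrite ler_wpM2l.
- by apply: fine_cvg; rewrite fineK; [exact: cG|exact: integrable_fin_num].
Qed.

Lemma integral_test_mean (a b : R) : a <= b ->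
  exists2 y, a <= y <= b & (\int[mu]_(x in `[a, b[) phi x)%R = phi y * (b - a).
Proof.
rewrite le_eqVlt => /predU1P[<-|ab].
  by exists a; rewrite ?lexx// set_itvco0// Rintegral_set0 subrr mulr0.
have ab' := ltW ab.
have wab : {within `[a, b], continuous phi} by exact: continuous_subspaceT.
have [M Mab leM] := EVT_max ab' wab.
have [m mab lem] := EVT_min ab' wab.
have iphi : mu.-integrable `[a, b[ (EFin \o phi).
  by apply: integrableS integrable_test.
have icst c : mu.-integrable `[a, b[ (EFin \o cst c).
  apply: (@integrableS _ _ _ mu `[a, b]) => //.
    by apply: subset_itvl; rewrite bnd_simp.
  apply: continuous_compact_integrable; first exact: segment_compact.
  by apply: continuous_subspaceT => x; exact: cvg_cst.
have intc c : (\int[mu]_(x in `[a, b[) cst c x)%R = c * (b - a).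
  by rewrite Rintegral_cst//= lebesgue_measure_itv/= lte_fin ab.
set J := (\int[mu]_(x in _) _)%R.
have Jm : phi m * (b - a) <= J.
  rewrite -intc; apply: le_Rintegral => // x /=; rewrite in_itv/= => /andP[ax xb].
  by apply: lem; rewrite in_itv/= ax ltW.
have JM : J <= phi M * (b - a).
  rewrite -intc; apply: le_Rintegral => // x /=; rewrite in_itv/= => /andP[ax xb].
  by apply: leM; rewrite in_itv/= ax ltW.
have ba0 : 0 < b - a by rewrite subr_gt0.
have vm : phi m <= J / (b - a) by rewrite ler_pdivlMr.
have vM : J / (b - a) <= phi M by rewrite ler_pdivrMr.
have [y yab phiy] : exists2 y, a <= y <= b & phi y = J / (b - a).
  move: Mab mab; rewrite !in_itv/= => /andP[aM Mb] /andP[am mb].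
  have [mM|Mm] := leP m M.
    have [|y] := @IVT R phi m M (J / (b - a)) mM (continuous_subspaceT phi_cont).
      by rewrite ge_min vm le_max vM orbT.
    rewrite in_itv/= => /andP[my yM] ye; exists y => //.
    by rewrite (le_trans am my) (le_trans yM Mb).
  have [|y] := @IVT R phi M m (J / (b - a)) (ltW Mm) (continuous_subspaceT phi_cont).
    by rewrite ge_min vm orbT le_max vM.
  rewrite in_itv/= => /andP[my yM] ye; exists y => //.
  by rewrite (le_trans aM my) (le_trans yM mb).
by exists y => //; rewrite phiy divfK// gt_eqF.
Qed.

Lemma riemann_density_ge0 p q u v t x : 0 <= u -> 0 <= v ->
  0 <= riemann_density p q u v t x :> R.
Proof.
move=> u0 v0; rewrite /riemann_density; case: ifP => _; last exact: riemann_profile_ge0.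
by case: ifP.
Qed.

Lemma riemann_density_le p q u v t x : 0 <= p -> 0 <= q -> 0 <= u -> 0 <= v ->
  riemann_density p q u v t x <= u + (1 + Num.sqrt (p / q)) * v :> R.
Proof.
move=> p0 q0 u0 v0; rewrite /riemann_density; case: ifP => _.
  rewrite mulrDl mul1r; have := mulr_ge0 (sqrtr_ge0 (p / q)) v0.
  by case: ifP => _; lra.
exact: riemann_profile_le.
Qed.

Lemma measurable_riemann_density p q u v t :
  measurable_fun [set: R] (riemann_density p q u v t).
Proof.
rewrite /riemann_density; case: (t == 0).
  by apply: measurable_fun_ifT => //; exact: measurable_fun_ltr.
apply: measurableT_comp; first exact: measurable_riemann_profile.
exact: measurable_funM.
Qed.

Definition riemann_pairing (p q u v t : R) : R :=
  (\int[mu]_x (phi x * riemann_density p q u v t x))%R +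
  atom_mass p q v t * phi (p * t).

(** The middle state is cut out of the shock profile because it is unbounded as q
    tends to 0. *)
Definition outer_profile (p s u v xi : R) : R :=
  if xi < p then u else if xi < s then 0 else v.

Lemma measurable_outer p s u v (t : R) :
  measurable_fun [set: R] (fun x => outer_profile p s u v (x / t)).
Proof.
have mt : measurable_fun [set: R] (fun x => x / t) by exact: measurable_funM.
apply: measurable_fun_ifT => //; first exact: measurable_fun_ltr.
by apply: measurable_fun_ifT => //; exact: measurable_fun_ltr.
Qed.

Lemma outer_profile_le p s u v xi : 0 <= u -> 0 <= v ->
  `|outer_profile p s u v xi| <= u + v.
Proof.
move=> u0 v0; rewrite /outer_profile; case: ifP => _; last case: ifP => _.
- by rewrite ger0_norm// lerDl.
- by rewrite normr0 addr_ge0.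
- by rewrite ger0_norm// lerDr.
Qed.

(** Shock and delta shock in one formula.  The middle state sqrt (p / q) v on an
    interval of length (sqrt (p q) + q) t carries the mass (p + sqrt (p q)) t v,
    and for q = 0 this is the mass of the atom. *)
Lemma riemann_pairing_shock p q u v t : 0 <= q -> q < p -> 0 < t ->
  0 <= u -> 0 <= v ->
  let s := p + Num.sqrt (p * q) + q in
  exists2 y, p * t <= y <= s * t & riemann_pairing p q u v t =
    (\int[mu]_x (phi x * outer_profile p s u v (x / t)))%R +
    (p + Num.sqrt (p * q)) * t * v * phi y.
Proof.
move=> q0 qp t0 u0 v0 s; rewrite /riemann_pairing /riemann_density gt_eqF//.
have p0 : 0 < p by exact: le_lt_trans qp.
have r0 : 0 <= Num.sqrt (p * q) by exact: sqrtr_ge0.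
have ps : p <= s by rewrite /s; lra.
have pts : p * t <= s * t by rewrite ler_pM2r.
have [q00|qN0] := eqVneq q 0.
  exists (p * t); first by rewrite lexx.
  rewrite /atom_mass q00 eqxx mulr0 sqrtr0 addr0; congr (_ + _).
  apply: eq_Rintegral => x _; rewrite /s q00 mulr0 sqrtr0 !addr0.
  rewrite /riemann_profile /outer_profile /fan_weight leNgt p0 /= mulr0 sqrtr0 !addr0.
  by case: ltP; rewrite ?mul1r.
have {}q0 : 0 < q by rewrite lt_def qN0.
have [y yps ye] := integral_test_mean _ _ pts.
exists y => //; rewrite /atom_mass (negPf qN0) mul0r addr0.
pose w := Num.sqrt (p / q) * v.
have iI : mu.-integrable setT (EFin \o (phi \_ `[p * t, s * t[)).
  have := (integrable_mkcond (mu := mu) (D := `[p * t, s * t[) (EFin \o phi)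
    ltac:(exact: measurable_itv)).1.
  rewrite restrict_EFin; apply.
  by apply: integrableS integrable_test.
transitivity (\int[mu]_x (phi x * outer_profile p s u v (x / t) +
    w * (phi \_ `[(p * t)%R, (s * t)%R[) x))%R.
  apply: eq_Rintegral => x _; rewrite patchE /riemann_profile /outer_profile.
  rewrite /fan_weight leNgt qp /= -/s.
  have xpt : (x / t < p) = (x < p * t) by rewrite ltr_pdivrMr.
  have xst : (x / t < s) = (x < s * t) by rewrite ltr_pdivrMr.
  rewrite mem_setE in_itv/= xpt xst.
  have [xp|px] /= := ltP x (p * t); first by rewrite mulr0 addr0.
  have [xs|sx] := ltP x (s * t); first by rewrite /w; ring.
  by rewrite [w * _]mulr0 addr0 mul1r.
rewrite RintegralD//; last 2 first.
- apply: (integrable_test_bounded _ (u + v)); first exact: measurable_outer.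
  by move=> x; exact: outer_profile_le.
- have := @integrableZl _ _ _ mu setT measurableT w _ iI.
  by [].
congr (_ + _); rewrite RintegralZl// -Rintegral_mkcond ye.
have root : Num.sqrt (p / q) * (s - p) = p + Num.sqrt (p * q).
  have -> : s - p = Num.sqrt (p * q) + q by rewrite /s; ring.
  rewrite mulrDr -sqrtrM ?divr_ge0 ?ltW// (_ : p / q * (p * q) = p ^+ 2); last first.
    by field.
  rewrite sqrtr_sqr gtr0_norm//; congr (_ + _).
  rewrite -{2}(gtr0_norm q0) -sqrtr_sqr -sqrtrM ?divr_ge0 ?ltW//.
  by congr Num.sqrt; field.
by rewrite /w -mulrBl -root; ring.
Qed.

(** For q > 0 the densities are bounded and converge off the two jumps.  For
    q = 0 eventually q_ n < p_ n, where shock and delta shock obey the same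
    formula, and the mass of the middle state concentrates at p t. *)
Lemma cvg_riemann_pairing_seq (p_ q_ : nat -> R) (p q u v t : R) :
  (forall n, 0 <= p_ n) -> (forall n, 0 <= q_ n) -> 0 <= p -> 0 <= q ->
  0 < p \/ 0 < q -> p_ @ \oo --> p -> q_ @ \oo --> q ->
  0 <= u -> 0 <= v -> 0 < t ->
  riemann_pairing (p_ n) (q_ n) u v t @[n --> \oo] --> riemann_pairing p q u v t.
Proof.
move=> p_0 q_0 p0 q0 pq0 pp qq u0 v0 t0.
have xt x r : x != r * t -> x / t != r.
  by apply: contra => /eqP <-; rewrite divfK// gt_eqF.
have [q00|qN0] := eqVneq q 0; last first.
  have {pq0}q0' : 0 < q by rewrite lt_def qN0.
  rewrite /riemann_pairing /atom_mass (negPf qN0) mul0r; apply: cvgD; last first.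
    apply: cvg_near_cst; have /cvgr_neq0 := qq => /(_ qN0).
    by apply: filterS => n qn; rewrite (negPf qn) mul0r.
  have cr : Num.sqrt (p_ n / q_ n) @[n --> \oo] --> Num.sqrt (p / q).
    by apply: cvg_sqrt; apply: cvgM => //; exact: cvgV.
  have [N [_ rN]] := cvg_seq_bounded (cvgP _ cr).
  have rM n : Num.sqrt (p_ n / q_ n) <= N + 1.
    by rewrite (le_trans (ler_norm _))//; apply: rN => //; rewrite ltrDl.
  set M := N + 1 in rM.
  apply: (cvg_integral_test _ _ (u + (1 + M) * v) (p * t)
    ((p + Num.sqrt (p * q) + q) * t)).
  - by move=> n; exact: measurable_riemann_density.
  - exact: measurable_riemann_density.
  - move=> n x; rewrite ger0_norm ?riemann_density_ge0//.
    rewrite (le_trans (riemann_density_le _ _ _ _ _ _ _ _ _ _))//.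
    rewrite lerD2l ler_wpM2r// lerD2l; exact: rM.
  - move=> x /xt xp /xt xs; rewrite /riemann_density gt_eqF//.
    exact: cvg_riemann_profile.
have {pq0}p0' : 0 < p by case: pq0 => //; rewrite q00 ltxx.
pose s_ n := p_ n + Num.sqrt (p_ n * q_ n) + q_ n.
have root0 : Num.sqrt (p_ n * q_ n) @[n --> \oo] --> 0.
  by rewrite -sqrtr0 -(mulr0 p) -q00; apply: cvg_sqrt; exact: cvgM.
have sp : s_ n @[n --> \oo] --> p.
  rewrite -[X in _ --> X]addr0 -q00 -[X in X + _]addr0.
  by apply: cvgD => //; exact: cvgD.
have near_qp : \forall n \near \oo, q_ n < p_ n.
  have /cvgr_gt : p_ n - q_ n @[n --> \oo] --> p - q by apply: cvgB.
  by rewrite q00 subr0 => /(_ 0 p0'); apply: filterS => n; rewrite subr_gt0.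
have /choice[y_ yP] : forall n, exists y, q_ n < p_ n ->
    p_ n * t <= y <= s_ n * t /\ riemann_pairing (p_ n) (q_ n) u v t =
    (\int[mu]_x (phi x * outer_profile (p_ n) (s_ n) u v (x / t)))%R +
    (p_ n + Num.sqrt (p_ n * q_ n)) * t * v * phi y.
  move=> n; have [qp|_] := ltP (q_ n) (p_ n); last by exists 0.
  by have [y yn ye] := riemann_pairing_shock _ _ u v t (q_0 n) qp t0 u0 v0; exists y.
have yp : y_ @ \oo --> p * t.
  apply: (@squeeze_cvgr _ _ _ _ (fun n => p_ n * t) (fun n => s_ n * t)).
  - by apply: filterS near_qp => n /yP[].
  - by apply: cvgM => //; exact: cvg_cst.
  - by apply: cvgM => //; exact: cvg_cst.
have -> : riemann_pairing p q u v t =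
    (\int[mu]_x (phi x * outer_profile p p u v (x / t)))%R +
    (p + 0) * t * v * phi (p * t).
  have qp : q < p by rewrite q00.
  have [y] := riemann_pairing_shock _ _ u v t q0 qp t0 u0 v0.
  rewrite q00 mulr0 sqrtr0 !addr0 => yp' ->.
  by rewrite (@le_anti _ _ y (p * t))// andbC.
apply: cvg_trans (near_eq_cvg _) _.
  by apply: filterS near_qp => n /yP[_ ->]; reflexivity.
apply: cvgD.
  apply: (cvg_integral_test _ _ (u + v) (p * t) (p * t)).
  - by move=> n; exact: measurable_outer.
  - exact: measurable_outer.
  - by move=> n x; exact: outer_profile_le.
  - move=> x /xt xp _; apply: cvg_lt_if => //; first exact: cvg_cst.
    by apply: cvg_lt_if => //; exact: cvg_cst.
apply: cvgM.
  do 2 (apply: cvgM; last exact: cvg_cst).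
  by apply: cvgD.
by apply: continuous_cvg => //; exact: phi_cont.
Qed.

End Functional.

(** * Convergence of the solutions *)

Definition is_riemann_measure {R : realType} (p q u v t : R)
    (nu : {measure set (measurableTypeR R) -> \bar R}) : Prop :=
  forall A : set (measurableTypeR R), measurable A ->
    (nu A = \int[@lebesgue_measure R]_(x in A) (riemann_density p q u v t x)%:E +
            (atom_mass p q v t)%:E * \d_(p * t)%R A)%E.

Section Components.
Context {R : realType}.
Local Notation mu := (@lebesgue_measure R).
Implicit Types (nu : {measure set (measurableTypeR R) -> \bar R}).

Lemma riemann_solution_components (a k : R) (U V : R * R) (W : R -> measure2 R)
    (t : R) :
  0 <= a -> 0 <= k -> riemann_solution a k U V W ->
  0 < lambda1 a k U \/ 0 < lambda1 a k V -> 0 <= t ->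
  is_riemann_measure (lambda1 a k U) (lambda1 a k V) U.1 V.1 t (W t).1 /\
  is_riemann_measure (lambda1 a k U) (lambda1 a k V) U.2 V.2 t (W t).2.
Proof.
move=> a0 k0 [ws pat WE] l0 t0.
have [prof sing] := wave_pattern_solved _ _ a0 k0 _ _ _ pat l0.
have dens x : density U V ws t x =
    (riemann_density (lambda1 a k U) (lambda1 a k V) U.1 V.1 t x,
     riemann_density (lambda1 a k U) (lambda1 a k V) U.2 V.2 t x).
  rewrite /density /riemann_density; case: (t == 0) => //.
  by case: ifP => _; rewrite -surjective_pairing.
split=> A mA; have [W1 W2] := WE t t0 A mA; have [s1 s2] := sing t t0 A.
  by rewrite W1 s1; congr (_ + _)%E; apply: eq_integral => x _; rewrite dens.
by rewrite W2 s2; congr (_ + _)%E; apply: eq_integral => x _; rewrite dens.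
Qed.

Lemma atom_mass_ge0 (p q v t : R) : 0 <= p -> 0 <= v -> 0 <= t ->
  0 <= atom_mass p q v t.
Proof. by move=> p0 v0 t0; rewrite /atom_mass; case: ifP; rewrite ?mulr_ge0. Qed.

Lemma riemann_measure_compact nu (p q u v t : R) (K : set R) :
  0 <= p -> 0 <= q -> 0 <= u -> 0 <= v -> 0 <= t ->
  is_riemann_measure p q u v t nu -> compact K -> (nu K < +oo)%E.
Proof.
move=> p0 q0 u0 v0 t0 nuE cK; have mK : measurable K by exact: compact_measurable.
set M := u + (1 + Num.sqrt (p / q)) * v.
have M0 : 0 <= M by rewrite addr_ge0// mulr_ge0// addr_ge0 ?sqrtr_ge0.
rewrite nuE//; apply: lte_add_pinfty.
  apply: (@le_lt_trans _ _ (\int[mu]_(x in K) cst M%:E x)%E).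
    apply: ge0_le_integral => //.
    - by move=> x _; rewrite lee_fin riemann_density_ge0.
    - apply/measurable_EFinP; apply: measurable_funTS.
      exact: measurable_riemann_density.
    - by move=> x _; rewrite lee_fin riemann_density_le.
  rewrite integral_cst// lte_mul_pinfty//; exact: compact_finite_measure.
rewrite diracE; case: (_ \in _); first by rewrite mule1 ltry.
by rewrite mule0 ltry.
Qed.

Lemma integral_riemann_measure nu (p q u v t : R) (phi : R -> R) :
  test_function phi -> (forall x, 0 <= phi x) ->
  0 <= p -> 0 <= q -> 0 <= u -> 0 <= v -> 0 <= t ->
  is_riemann_measure p q u v t nu ->
  (\int[nu]_x (phi x)%:E)%E = (riemann_pairing phi p q u v t)%:E.
Proof.
move=> phiT phi0 p0 q0 u0 v0 t0 nuE.
rewrite (integral_density_atom mu (riemann_density p q u v t) _ _ nu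
  (atom_mass p q v t) (p * t) phi)//.
- rewrite /riemann_pairing EFinD; congr (_ + _)%E.
  rewrite fineK//; apply: integrable_fin_num => //.
  apply: (integrable_test_bounded _ phiT _ (u + (1 + Num.sqrt (p / q)) * v)).
    exact: measurable_riemann_density.
  by move=> x; rewrite ger0_norm ?riemann_density_ge0// riemann_density_le.
- exact: measurable_riemann_density.
- by move=> x; exact: riemann_density_ge0.
- exact: atom_mass_ge0.
- exact: measurable_test.
Qed.

Lemma cvg_riemann_pairing (phi : R -> R) (p_ q_ : R -> R) (p q u v t : R) :
  test_function phi -> (forall x, 0 <= phi x) ->
  (forall k, 0 < k -> 0 <= p_ k) -> (forall k, 0 < k -> 0 <= q_ k) ->
  0 <= p -> 0 <= q -> 0 < p \/ 0 < q ->
  p_ @ 0^'+ --> p -> q_ @ 0^'+ --> q -> 0 <= u -> 0 <= v -> 0 <= t ->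
  riemann_pairing phi (p_ k) (q_ k) u v t @[k --> 0^'+] -->
  riemann_pairing phi p q u v t.
Proof.
move=> phiT phi0 p_0 q_0 p0 q0 pq0 pp qq u0 v0.
rewrite le_eqVlt => /predU1P[<-|t0].
  have at0 p' q' : riemann_pairing phi p' q' u v 0 =
      (\int[mu]_x (phi x * (if x < 0 then u else v)))%R.
    rewrite /riemann_pairing /atom_mass mulr0 mul0r if_same mul0r addr0.
    by apply: eq_Rintegral => x _; rewrite /riemann_density eqxx.
  by rewrite at0; under eq_fun do rewrite at0; exact: cvg_cst.
apply/cvg_at_rightP => k_ [k_0 k_cvg].
apply: cvg_riemann_pairing_seq => //.
- by move=> n; exact: p_0.
- by move=> n; exact: q_0.
- by apply: (cvg_at_rightP _ _ _).1 pp _ _.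
- by apply: (cvg_at_rightP _ _ _).1 qq _ _.
Qed.

Lemma test_function_max0 (phi : R -> R) : test_function phi ->
  test_function (fun x => Num.max (phi x) 0).
Proof.
move=> [cphi Kphi]; split.
  by move=> x; exact: (cvg_maxr _ _ _ _ (cphi x) (cvg_cst _)).
apply: subclosed_compact Kphi _; first exact: closed_closure.
apply: closure_subset => x /=; apply: contra => /eqP ->.
by rewrite maxxx.
Qed.

Lemma test_functionN (phi : R -> R) : test_function phi ->
  test_function (fun x => - phi x).
Proof.
move=> [cphi Kphi]; split; first by move=> x; apply: cvgN; exact: cphi.
by under eq_set do rewrite oppr_eq0.
Qed.

(** The positive and negative parts of a test function are again test functions,
    so that it suffices to pair with nonnegative ones. *)
Lemma cvg_integral_riemann_measure
    (nu_ : R -> {measure set (measurableTypeR R) -> \bar R}) nu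
    (p_ q_ : R -> R) (p q u v t : R) (phi : R -> R) :
  test_function phi ->
  (forall k, 0 < k -> 0 <= p_ k) -> (forall k, 0 < k -> 0 <= q_ k) ->
  0 <= p -> 0 <= q -> 0 < p \/ 0 < q ->
  p_ @ 0^'+ --> p -> q_ @ 0^'+ --> q -> 0 <= u -> 0 <= v -> 0 <= t ->
  (forall k, 0 < k -> is_riemann_measure (p_ k) (q_ k) u v t (nu_ k)) ->
  is_riemann_measure p q u v t nu ->
  (\int[nu_ k]_x (phi x)%:E @[k --> 0^'+] --> \int[nu]_x (phi x)%:E)%E.
Proof.
move=> phiT p_0 q_0 p0 q0 pq0 pp qq u0 v0 t0 nu_E nuE.
have posE (n : {measure set (measurableTypeR R) -> \bar R}) :
    (\int[n]_x (phi x)%:E = \int[n]_x (Num.max (phi x) 0)%:E -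
                            \int[n]_x (Num.max (- phi x) 0)%:E)%E.
  rewrite integralE; congr (_ - _)%E; apply: eq_integral => x _.
    by rewrite funeposE /= EFin_max.
  by rewrite funenegE /= EFin_max.
have cvg0 psi : test_function psi -> (forall x, 0 <= psi x) ->
    (\int[nu_ k]_x (psi x)%:E @[k --> 0^'+] --> \int[nu]_x (psi x)%:E)%E /\
    (\int[nu]_x (psi x)%:E \is a fin_num)%E.
  move=> psiT psi0; rewrite (integral_riemann_measure nu p q u v t)//; split => //.
  have := cvg_riemann_pairing psi p_ q_ p q u v t psiT psi0 p_0 q_0 p0 q0 pq0 pp qq
    u0 v0 t0.
  move=> cp; have {}cp : ((riemann_pairing psi (p_ k) (q_ k) u v t)%:E
      @[k --> 0^'+] --> (riemann_pairing psi p q u v t)%:E)%E.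
    by apply: cvg_EFin; [exact: nearW|exact: cp].
  apply: cvg_trans cp; apply: near_eq_cvg; near=> k.
  have k0 : 0 < k by near: k; exact: nbhs_right_gt.
  rewrite (integral_riemann_measure (nu_ k) (p_ k) (q_ k) u v t)//;
    [exact: p_0|exact: q_0|exact: nu_E].
have max0 (f : R -> R) x : 0 <= Num.max (f x) 0 by rewrite le_max lexx orbT.
rewrite posE; under eq_fun do rewrite posE.
have [c1 f1] := cvg0 _ (test_function_max0 _ phiT) (max0 _).
have [c2 f2] := cvg0 _ (test_function_max0 _ (test_functionN _ phiT)) (max0 _).
by apply: cvgeB => //; apply: fin_num_adde_defl; rewrite fin_numN.
Unshelve. all: by end_near. Qed.

(** Both limits of the theorem are instances: (a_, k_) = (1/2, kappa) and
    (alpha, 1). *)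
Lemma Mloc_cvg_riemann (a_ k_ : R -> R) (a k : R) (U V : R * R)
    (W_ : R -> R -> measure2 R) (W : R -> measure2 R) (t : R) :
  in_state_space U -> in_state_space V ->
  (forall e, 0 < e -> 0 <= a_ e) -> (forall e, 0 < e -> 0 <= k_ e) ->
  0 <= a -> 0 <= k -> a_ @ 0^'+ --> a -> k_ @ 0^'+ --> k ->
  (forall e, 0 < e ->
     0 < lambda1 (a_ e) (k_ e) U \/ 0 < lambda1 (a_ e) (k_ e) V) ->
  0 < lambda1 a k U \/ 0 < lambda1 a k V ->
  (forall e, 0 < e -> riemann_solution (a_ e) (k_ e) U V (W_ e)) ->
  riemann_solution a k U V W -> 0 <= t ->
  Mloc_cvg 0^'+ (fun e => W_ e t) (W t).
Proof.
move=> US VS a_0 k_0 a0 k0 aa kk l_0 l0 W_E WE t0.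
have [[u10 u20] [v10 v20]] := (US, VS).
have cl Z : lambda1 (a_ e) (k_ e) Z @[e --> 0^'+] --> lambda1 a k Z.
  rewrite /lambda1; apply: cvgD; repeat (apply: cvgM; last exact: cvg_cst); by [].
have p_0 Z e : in_state_space Z -> 0 < e -> 0 <= lambda1 (a_ e) (k_ e) Z.
  by move=> ZS e0; apply: lambda1_ge0 => //; [exact: a_0|exact: k_0].
have [p0 q0] : 0 <= lambda1 a k U /\ 0 <= lambda1 a k V.
  by split; apply: lambda1_ge0.
have [W1 W2] := riemann_solution_components _ _ _ _ _ _ a0 k0 WE l0 t0.
have W_12 e : 0 < e -> _ := fun e0 => riemann_solution_components _ _ _ _ _ t
  (a_0 e e0) (k_0 e e0) (W_E e e0) (l_0 e e0) t0.
split.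
- near=> e; have e0 : 0 < e by near: e; exact: nbhs_right_gt.
  move=> K cK; have [We1 We2] := W_12 e e0.
  by split; [apply: riemann_measure_compact We1 cK|
             apply: riemann_measure_compact We2 cK] => //; exact: p_0.
- move=> K cK; by split; [apply: riemann_measure_compact W1 cK|
             apply: riemann_measure_compact W2 cK].
- move=> phi phiT; split.
    apply: (cvg_integral_riemann_measure _ _ _ _ _ _ _ _ _ _ phiT _ _ p0 q0 l0
      (cl U) (cl V) u10 v10 t0) => //.
    + by move=> e; exact: p_0.
    + by move=> e; exact: p_0.
    + by move=> e /W_12[].
  apply: (cvg_integral_riemann_measure _ _ _ _ _ _ _ _ _ _ phiT _ _ p0 q0 l0
    (cl U) (cl V) u20 v20 t0) => //.
  + by move=> e; exact: p_0.
  + by move=> e; exact: p_0.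
  + by move=> e /W_12[].
Unshelve. all: by end_near. Qed.

Lemma lambda1_gt0 (a k : R) (U : R * R) : 0 <= a -> 0 <= k -> 0 < a + k ->
  0 < U.1 -> 0 < U.2 -> 0 < lambda1 a k U.
Proof.
move=> a0 k0 ak0 h0 b0; rewrite /lambda1.
have hb : 0 < U.1 * U.2 by exact: mulr_gt0.
have hh : 0 < U.1 ^+ 2 / 3 by rewrite divr_gt0// exprn_gt0.
move: a0; rewrite le_eqVlt => /predU1P[a0|a0].
  rewrite -a0 add0r in ak0 *; rewrite !mul0r add0r -mulrA; exact: mulr_gt0.
by rewrite ltr_pwDl// -mulrA ?mulr_gt0// mulr_ge0// ltW.
Qed.

End Components.

Theorem theorem1p4 (R : realType) (hm bm hp bp : R)
  (hm0 : 0 <= hm) (bm0 : 0 <= bm) (hp0 : 0 <= hp) (bp0 : 0 <= bp)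
  (at_most_one_zero : (count (pred1 (0 : R)%R) [:: hm; hp; bm; bp] <= 1)%N)
  (T : R) (T0 : 0 < T) :
  (forall (U : R -> R -> measure2 R) (Ulim : R -> measure2 R),
     (forall kappa : R, 0 < kappa ->
        riemann_solution (1 / 2) kappa (hm, bm) (hp, bp) (U kappa)) ->
     riemann_solution (1 / 2) 0 (hm, bm) (hp, bp) Ulim ->
     forall t : R, 0 <= t <= T ->
       Mloc_cvg 0^'+ (fun kappa => U kappa t) (Ulim t))
  /\
  (forall (U : R -> R -> measure2 R) (Ulim : R -> measure2 R),
     (forall alpha : R, 0 < alpha ->
        riemann_solution alpha 1 (hm, bm) (hp, bp) (U alpha)) ->
     riemann_solution 0 1 (hm, bm) (hp, bp) Ulim ->
     forall t : R, 0 <= t <= T ->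
       Mloc_cvg 0^'+ (fun alpha => U alpha t) (Ulim t)).
Proof.
have pos (a k : R) : 0 <= a -> 0 <= k -> 0 < a + k ->
    0 < lambda1 a k (hm, bm) \/ 0 < lambda1 a k (hp, bp).
  move=> a0 k0 ak0.
  have [[hmN bmN]|[hpN bpN]] : (hm != 0 /\ bm != 0) \/ (hp != 0 /\ bp != 0).
    move: at_most_one_zero => /=.
    do 4 (case: eqVneq => _ /=); by [left|right|].
  - by left; apply: lambda1_gt0; rewrite //= lt_def ?hmN ?bmN.
  - by right; apply: lambda1_gt0; rewrite //= lt_def ?hpN ?bpN.
have half0 : 0 <= 1 / 2 :> R by rewrite divr_ge0.
split=> U Ulim UE UlimE t /andP[t0 _].
- apply: (Mloc_cvg_riemann (cst (1 / 2)) id (1 / 2) 0 (hm, bm) (hp, bp)) => //.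
  + by move=> e /ltW.
  + exact: cvg_cst.
  + exact: cvg_at_right_filter.
  + by move=> e e0; apply: pos => //; [exact: ltW|exact: ltr_wpDl].
  + by apply: pos => //; rewrite addr0 divr_gt0.
- apply: (Mloc_cvg_riemann id (cst 1) 0 1 (hm, bm) (hp, bp)) => //.
  + by move=> e /ltW.
  + exact: cvg_at_right_filter.
  + exact: cvg_cst.
  + by move=> e e0; apply: pos => //; [exact: ltW|exact: ltr_wpDr].
  + by apply: pos => //; rewrite add0r.
Qed.
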